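(* Let $K$ be a non-empty compact Hausdorff space and let $A$ be a closed, densely defined and real operator on $E:=C(K)$. Suppose that $\lambda_0\in\mathbb{R}$ is an eigenvalue of $A$ and a pole of the resolvent $R(\cdot,A)$. Let $P$ be the spectral projection associated with $\lambda_0$. Then the following assertions are equivalent: (i) $P\gg 0$. (ii) The eigenvalue $\lambda_0$ of $A$ is geometrically simple, and $\ker(\lambda_0I-A)$ and $\ker(\lambda_0I-A')$ each contain a strongly positive vector. (iii) The eigenvalue $\lambda_0$ of $A$ is algebraically simple, $\ker(\lambda_0I-A)$ contains a strongly positive vector, and $\operatorname{im}(\lambda_0I-A)\cap E_+=\{0\}$. If assertions (i)–(iii) are fulfilled, then $\lambda_0$ is a simple pole of the resolvents $R(\cdot,A)$ and $R(\cdot,A')$. Moreover, $\dim(\operatorname{im}P)=\dim(\operatorname{im}P')=1$, and $\lambda_0$ is the only eigenvalue of $A$ having a positive eigenvector.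
   Context: $C(K)$ is the space of complex-valued continuous functions on $K$ with the supremum norm, $E_+=\{f\in C(K): f(x)\ge 0\ \forall x\in K\}$. For $f\in C(K)$: $f\ge0$ (''positive'') means $f\in E_+$; $f>0$ means $f\ge 0$ and $f\ne 0$; $f\gg 0$ (''strongly positive'') means there is $\beta>0$ with $f\ge\beta\mathbf{1}$. A bounded operator $T$ on $C(K)$ satisfies $T\gg 0$ if $Tf\gg 0$ for all $f>0$. A functional $\varphi\in C(K)'$ is strongly positive if $\varphi(f)>0$ for all $f>0$. An operator $A$ on $C(K)$ is real if $x+iy\in D(A)$ with $x,y$ real-valued implies $x,y\in D(A)$, and $A$ maps real-valued functions in $D(A)$ to real-valued functions. $R(\lambda,A)=(\lambda I-A)^{-1}$; $A'$, $P'$ are the dual operators. The spectral projection associated with an isolated spectral value $\lambda_0$ is the residue of $R(\cdot,A)$ at $\lambda_0$. Geometrically simple: $\dim\ker(\lambda_0I-A)=1$. Algebraically simple: the generalised eigenspace $\bigcup_{m\in\mathbb{N}}\ker(\lambda_0I-A)^m$ has dimension one. *)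

(* Defs.v *)
From HB Require Import structures.
From mathcomp Require Import all_boot all_order all_algebra.
From mathcomp Require Import all_classical all_reals all_analysis.
From mathcomp.real_closed Require Import complex.

Set Implicit Arguments.
Unset Strict Implicit.
Unset Printing Implicit Defensive.

Import Order.TTheory GRing.Theory Num.Theory.
Import numFieldNormedType.Exports.

Local Open Scope classical_set_scope.
Local Open Scope ring_scope.

(* R[i] itself carries an R-module structure which hides its C-module
   structure; through this name it is a normed module over itself. *)
Definition Cplx (R : realType) : numClosedFieldType := R[i].

Definition toC (R : realType) (x : R) : Cplx R := (x%:C)%C.

(* Norms of normed modules over Cplx R take their values in Cplx R, hence
   the passage through real parts to take suprema. *)
Definition sup_norm (R : realType) (V : normedModType (Cplx R))
    (I : Type) (D : set I) (g : I -> V) : Cplx R :=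
  toC (sup [set complex.Re (`|g i| : Cplx R) | i in D]).

Section SupNorm.
Context (R : realType).
Local Notation C := (Cplx R).

Lemma toC_le (x y : R) : (toC x <= toC y) = (x <= y).
Proof. exact: lecR. Qed.

Lemma toC_Re (z : C) : 0 <= z -> toC (complex.Re z) = z.
Proof.
case: z => a b; rewrite lecE => /andP[/eqP b0 _].
exact: (congr1 (Complex a) (esym b0)).
Qed.

Lemma Re_ge0 (z : C) : 0 <= z -> 0 <= complex.Re z.
Proof. by rewrite lecE /= => /andP[]. Qed.

Lemma Re_le (z w : C) : 0 <= z -> z <= w -> complex.Re z <= complex.Re w.
Proof. by move=> z0 zw; rewrite -toC_le !toC_Re// (le_trans z0). Qed.

Context (V : normedModType C) (I : Type) (D : set I).
Implicit Type g : I -> V.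

Lemma sup_norm_ge0 g : 0 <= sup_norm D g.
Proof.
suff: toC 0 <= sup_norm D g by [].
rewrite toC_le; set S := [set _ | _ in D].
have [sS|/sup_out -> //] := pselect (has_sup S).
have [[_ [i Di _]] ub] := sS.
apply: (le_trans _ (ub_le_sup ub _)); last by exists i.
exact/Re_ge0/normr_ge0.
Qed.

Lemma sup_norm_ub g (M : C) : (forall i, D i -> `|g i| <= M) ->
  forall i, D i -> `|g i| <= sup_norm D g.
Proof.
move=> gM i Di; rewrite -[`|g i|]toC_Re// toC_le; apply: ub_le_sup; last by exists i.
by exists (complex.Re M) => _ [j Dj <-]; apply: Re_le => //; exact: gM.
Qed.

Lemma sup_norm_le g (M : C) : 0 <= M -> (forall i, D i -> `|g i| <= M) ->
  sup_norm D g <= M.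
Proof.
move=> M0 gM; rewrite -(toC_Re M0) toC_le.
have [[i Di]|D0] := pselect (D !=set0).
  apply: ge_sup; first by exists (complex.Re (`|g i| : C)), i.
  by move=> _ [j Dj <-]; apply: Re_le => //; exact: gM.
rewrite (_ : [set _ | _ in D] = set0) ?sup0 ?Re_ge0//.
by apply/seteqP; split => // x [j Dj _]; case: D0; exists j.
Qed.

End SupNorm.

Section ContinuousFunctions.
Context (R : realType) (K : topologicalType).
Local Notation C := (Cplx R).

(* Compactness of K is a parameter because the supremum norm needs it. *)
Definition CK (cK : compact [set: K]) : Type := continuousType K C.

Context (cK : compact [set: K]).
Local Notation E := (CK cK).

HB.instance Definition _ := Choice.copy E (continuousType K C).

Definition CK_fun (f : E) : K -> C := @Continuous.sort K C f.
Coercion CK_fun : CK >-> Funclass.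

Definition mkCK (f : K -> C) (cf : continuous f) : E :=
  (mkcts cf : continuousType K C).

Lemma CK_continuous (f : E) : continuous f.
Proof. exact: (@cts_fun _ _ f). Qed.

Lemma CKP (f g : E) : f =1 g -> f = g.
Proof. by move=> fg; apply/(@continuousEP K C f g). Qed.

Definition CK_zero : E := @mkCK (cst 0) (fun x => cvg_cst _).

Definition CK_opp (f : E) : E :=
  @mkCK (fun t => - f t) (fun t => cvgN (@CK_continuous f t)).

Definition CK_add (f g : E) : E :=
  @mkCK (fun t => f t + g t)
    (fun t => cvgD (@CK_continuous f t) (@CK_continuous g t)).

Definition CK_scale (a : C) (f : E) : E :=
  @mkCK (fun t => a * f t) (fun t => cvgMr (a := a) (@CK_continuous f t)).

Fact CK_addA : associative CK_add.
Proof. by move=> f g h; apply: CKP => t; exact: addrA. Qed.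
Fact CK_addC : commutative CK_add.
Proof. by move=> f g; apply: CKP => t; exact: addrC. Qed.
Fact CK_add0 : left_id CK_zero CK_add.
Proof. by move=> f; apply: CKP => t; exact: add0r. Qed.
Fact CK_addN : left_inverse CK_zero CK_opp CK_add.
Proof. by move=> f; apply: CKP => t; exact: addNr. Qed.

HB.instance Definition _ :=
  GRing.isZmodule.Build E CK_addA CK_addC CK_add0 CK_addN.

Fact CK_scaleA a b (f : E) : CK_scale a (CK_scale b f) = CK_scale (a * b) f.
Proof. by apply: CKP => t; exact: mulrA. Qed.
Fact CK_scale1 : left_id 1 CK_scale.
Proof. by move=> f; apply: CKP => t; exact: mul1r. Qed.
Fact CK_scaleDr : right_distributive CK_scale +%R.
Proof. by move=> a f g; apply: CKP => t; exact: mulrDr. Qed.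
Fact CK_scaleDl (f : E) : {morph CK_scale^~ f : a b / a + b}.
Proof. by move=> a b; apply: CKP => t; exact: mulrDl. Qed.

HB.instance Definition _ := GRing.Zmodule_isLmodule.Build C E
  CK_scaleA CK_scale1 CK_scaleDr CK_scaleDl.

Definition CK_norm (f : E) : C := sup_norm [set: K] f.

Lemma CK_bounded (f : E) : exists M : C, forall t, `|f t| <= M.
Proof.
pose g t : R := complex.Re (`|f t| : C).
have gE t : toC (g t) = `|f t| by rewrite toC_Re.
have cg : continuous g.
  move=> t; apply/cvgrPdist_lt => e e0.
  have eC : 0 < toC e by rewrite ltcR.
  have /cvgrPdist_lt/(_ _ eC) := @CK_continuous f t.
  apply: filterS => s fts; rewrite ltr_distl.
  rewrite -!(ltcR (g t)) -!(ltcR _ (g t)) -/(toC _) -/(toC (_ + _)).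
  rewrite /toC rmorphB rmorphD /= -!/(toC _) !gE ltrBlDr.
  apply/andP; split.
    rewrite -ltrBlDl (le_lt_trans _ fts)// distrC.
    by rewrite (le_trans _ (lerB_dist _ _)).
  by rewrite -ltrBlDl (le_lt_trans (lerB_dist _ _)).
have /compact_bounded/pinfty_ex_gt0[M M0 gM] : compact (g @` setT).
  by apply: continuous_compact => //; exact: continuous_subspaceT.
exists (toC M) => t; rewrite -gE toC_le.
by rewrite (le_trans (ler_norm _))//; apply: gM; exists t.
Qed.

Fact CK_normD (f g : E) : CK_norm (f + g) <= CK_norm f + CK_norm g.
Proof.
have [[M fM] [N gN]] := (CK_bounded f, CK_bounded g).
apply: sup_norm_le => [|t _]; first by rewrite addr_ge0// sup_norm_ge0.
rewrite (le_trans (ler_normD (f t) (g t)))// lerD//.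
  by apply: (@sup_norm_ub R C K setT f M).
by apply: (@sup_norm_ub R C K setT g N).
Qed.

Fact CK_normZ (a : C) (f : E) : CK_norm (a *: f) = `|a| * CK_norm f.
Proof.
have le b (h : E) : CK_norm (b *: h) <= `|b| * CK_norm h.
  have [M hM] := CK_bounded h.
  apply: sup_norm_le => [|t _]; first by rewrite mulr_ge0// sup_norm_ge0.
  suff: `|b * h t| <= `|b| * CK_norm h by [].
  by rewrite normrM ler_wpM2l// (@sup_norm_ub R C K setT h M).
apply/eqP; rewrite eq_le le /=.
have [->|a0] := eqVneq a 0; first by rewrite normr0 mul0r sup_norm_ge0.
by rewrite -ler_pdivlMl ?normr_gt0// -normfV -{1}(scalerK a0 f) le.
Qed.

Fact CK_norm0 (f : E) : CK_norm f = 0 -> f = 0.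
Proof.
have [M fM] := CK_bounded f.
move=> f0; apply: CKP => t; apply/eqP; rewrite -normr_le0 -f0.
by apply: (@sup_norm_ub R C K setT f M).
Qed.

HB.instance Definition _ :=
  Lmodule_isNormed.Build C E CK_normD CK_normZ CK_norm0.

End ContinuousFunctions.

#[short(type="boundedType")]
HB.structure Definition Bounded (R : realType)
    (X Y : normedModType (Cplx R)) :=
  {f of @GRing.Linear (Cplx R) X Y *:%R f & @Continuous X Y f}.

Notation "{ 'bounded' X -> Y }" := (boundedType X%type Y%type)
  (at level 0, X at level 98, Y at level 99,
   format "{ 'bounded'  X  ->  Y }") : type_scope.

Section BoundedOperators.
Context (R : realType) (X Y : normedModType (Cplx R)).
Local Notation C := (Cplx R).
Local Notation B := {bounded X -> Y}.

HB.instance Definition _ := gen_eqMixin B.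
HB.instance Definition _ := gen_choiceMixin B.

Lemma boundedP (S T : B) : S =1 T -> S = T.
Proof.
case: S T => f [[a] [b] [c]] [g [[a'] [b'] [c']]] /= /funext fg.
subst g.
congr Bounded.Pack.
congr Bounded.Class.
all: congr (_ _); exact: Prop_irrelevance.
Qed.

Definition mkBounded (f : X -> Y) (lf : linear f) (cf : continuous f) : B :=
  HB.pack f (GRing.isLinear.Build C X Y *:%R f lf) (isContinuous.Build X Y f cf).

Lemma le_continuous (f : X -> Y) (lf : linear f) (M : C) : 0 <= M ->
  (forall x, `|f x| <= M * `|x|) -> continuous f.
Proof.
move=> M0 fM; apply: (@bounded_linear_continuous _ _ _
  (HB.pack_for {linear X -> Y} f (GRing.isLinear.Build C X Y *:%R f lf))).
apply/linear_boundedP; exists M; split; first exact: ger0_real.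
by move=> N /ltW MN x; rewrite (le_trans (fM x))// ler_wpM2r.
Qed.

Lemma bounded_continuous (T : B) : continuous T.
Proof. exact: (@cts_fun _ _ T). Qed.

Lemma bounded_le (T : B) :
  exists2 M : C, 0 <= M & forall x, `|T x| <= M * `|x|.
Proof.
have /linear_bounded_continuous/linear_boundedP := @bounded_continuous T.
by move=> /pinfty_ex_gt0[M M0 TM]; exists M => //; exact: ltW.
Qed.

Definition bounded_norm (T : B) : C := sup_norm [set x : X | `|x| <= 1] T.

Lemma bounded_norm_ub (T : B) x : `|T x| <= bounded_norm T * `|x|.
Proof.
have [M M0 TM] := bounded_le T.
have [->|x0] := eqVneq x 0; first by rewrite linear0 !normr0 mulr0.
rewrite -ler_pdivrMr ?normr_gt0//.
have -> : `|T x| / `|x| = `|T (`|x|^-1 *: x)|.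
  by rewrite linearZ normrZ normfV normr_id mulrC.
apply: (@sup_norm_ub R Y X _ T M) => [y /= y1|/=].
  by rewrite (le_trans (TM y))// ler_piMr.
by rewrite normrZ normfV normr_id mulVf ?normr_eq0.
Qed.

Lemma bounded_norm_le (T : B) (M : C) : 0 <= M ->
  (forall x, `|T x| <= M * `|x|) -> bounded_norm T <= M.
Proof.
move=> M0 TM; apply: sup_norm_le => // x x1.
by rewrite (le_trans (TM x))// ler_piMr.
Qed.

Definition bounded_zero : B :=
  @mkBounded (cst 0) (fun a x y => esym (etrans (addr0 _) (scaler0 _ a)))
    (fun x => cvg_cst _).

Fact bounded_opp_linear (T : B) : linear (fun x => - T x).
Proof. by move=> a x y; rewrite linearP opprD scalerN. Qed.

Definition bounded_opp (T : B) : B :=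
  mkBounded (bounded_opp_linear T) (fun x => cvgN (@bounded_continuous T x)).

Fact bounded_add_linear (S T : B) : linear (fun x => S x + T x).
Proof. by move=> a x y; rewrite !linearP scalerDr addrACA. Qed.

Definition bounded_add (S T : B) : B :=
  mkBounded (bounded_add_linear S T)
    (fun x => cvgD (@bounded_continuous S x) (@bounded_continuous T x)).

Fact bounded_scale_linear (a : C) (T : B) : linear (fun x => a *: T x).
Proof. by move=> b x y; rewrite linearP scalerDr !scalerA mulrC. Qed.

Definition bounded_scale (a : C) (T : B) : B :=
  mkBounded (bounded_scale_linear a T)
    (fun x => cvgZr (k := a) (@bounded_continuous T x)).

Fact bounded_addA : associative bounded_add.
Proof. by move=> S T U; apply: boundedP => x; exact: addrA. Qed.
Fact bounded_addC : commutative bounded_add.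
Proof. by move=> S T; apply: boundedP => x; exact: addrC. Qed.
Fact bounded_add0 : left_id bounded_zero bounded_add.
Proof. by move=> S; apply: boundedP => x; exact: add0r. Qed.
Fact bounded_addN : left_inverse bounded_zero bounded_opp bounded_add.
Proof. by move=> S; apply: boundedP => x; exact: addNr. Qed.

HB.instance Definition _ := GRing.isZmodule.Build B
  bounded_addA bounded_addC bounded_add0 bounded_addN.

Fact bounded_scaleA a b (T : B) :
  bounded_scale a (bounded_scale b T) = bounded_scale (a * b) T.
Proof. by apply: boundedP => x; exact: scalerA. Qed.
Fact bounded_scale1 : left_id 1 bounded_scale.
Proof. by move=> T; apply: boundedP => x; exact: scale1r. Qed.
Fact bounded_scaleDr : right_distributive bounded_scale +%R.
Proof. by move=> a S T; apply: boundedP => x; exact: scalerDr. Qed.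
Fact bounded_scaleDl (T : B) : {morph bounded_scale^~ T : a b / a + b}.
Proof. by move=> a b; apply: boundedP => x; exact: scalerDl. Qed.

HB.instance Definition _ := GRing.Zmodule_isLmodule.Build C B
  bounded_scaleA bounded_scale1 bounded_scaleDr bounded_scaleDl.

Fact bounded_normD (S T : B) :
  bounded_norm (S + T) <= bounded_norm S + bounded_norm T.
Proof.
apply: bounded_norm_le => [|x]; first by rewrite addr_ge0// sup_norm_ge0.
by rewrite mulrDl (le_trans (ler_normD (S x) (T x)))// lerD// bounded_norm_ub.
Qed.

Fact bounded_normZ (a : C) (T : B) :
  bounded_norm (a *: T) = `|a| * bounded_norm T.
Proof.
have le b (S : B) : bounded_norm (b *: S) <= `|b| * bounded_norm S.
  apply: bounded_norm_le => [|x]; first by rewrite mulr_ge0// sup_norm_ge0.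
  suff: `|b *: S x| <= `|b| * bounded_norm S * `|x| by [].
  by rewrite normrZ -mulrA ler_wpM2l// bounded_norm_ub.
apply/eqP; rewrite eq_le le /=.
have [->|a0] := eqVneq a 0; first by rewrite normr0 mul0r sup_norm_ge0.
by rewrite -ler_pdivlMl ?normr_gt0// -normfV -{1}(scalerK a0 T) le.
Qed.

Fact bounded_norm0 (T : B) : bounded_norm T = 0 -> T = 0.
Proof.
move=> T0; apply: boundedP => x; apply/eqP; rewrite -normr_le0.
by rewrite (le_trans (bounded_norm_ub T x))// T0 mul0r.
Qed.

HB.instance Definition _ :=
  Lmodule_isNormed.Build C B bounded_normD bounded_normZ bounded_norm0.

End BoundedOperators.

Definition dual (R : realType) (X : normedModType (Cplx R))
  : normedModType (Cplx R) := {bounded X -> Cplx R}.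

Section DualBounded.
Context (R : realType) (X Y : normedModType (Cplx R)) (T : {bounded X -> Y}).

Fact pullback_linear (phi : dual Y) : linear (phi \o T).
Proof. by move=> a x y /=; rewrite !linearP. Qed.

Fact pullback_continuous (phi : dual Y) : continuous (phi \o T).
Proof.
by move=> x; apply: continuous_comp; exact: bounded_continuous.
Qed.

Definition pullback (phi : dual Y) : dual X :=
  mkBounded (pullback_linear phi) (@pullback_continuous phi).

Fact dual_bounded_linear : linear pullback.
Proof. by move=> a phi psi; apply: boundedP. Qed.

Fact dual_bounded_continuous : continuous pullback.
Proof.
apply: (@le_continuous _ _ _ _ dual_bounded_linear _ (sup_norm_ge0 _ T)) => phi.
rewrite mulrC; apply: bounded_norm_le => [|x].
  by rewrite mulr_ge0// sup_norm_ge0.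
rewrite (le_trans (bounded_norm_ub phi (T x)))// -mulrA.
by apply: ler_wpM2l; [exact: sup_norm_ge0|exact: bounded_norm_ub].
Qed.

Definition dual_bounded : {bounded dual Y -> dual X} :=
  mkBounded dual_bounded_linear dual_bounded_continuous.

End DualBounded.

(* The values of op_fun outside dom are irrelevant. *)
Record operator (R : realType) (X : normedModType (Cplx R)) := Operator {
  dom : set X;
  op_fun :> X -> X;
  dom0 : dom 0;
  dom_linear : forall a x y, dom x -> dom y -> dom (a *: x + y);
  op_linear : forall a x y, dom x -> dom y ->
    op_fun (a *: x + y) = a *: op_fun x + op_fun y
}.

Section Operators.
Context (R : realType) (X : normedModType (Cplx R)).
Local Notation C := (Cplx R).
Implicit Types A B : operator X.

Lemma op0 A : A 0 = 0.
Proof.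
have := op_linear 1 (dom0 A) (dom0 A).
by rewrite !scale1r addr0 -[X in X = _]addr0 => /addrI.
Qed.

Definition ker_op A : set X := [set x | dom A x /\ A x = 0].
Definition im_op A : set X := A @` dom A.

Definition closed_operator A :=
  closed [set p : X * X | dom A p.1 /\ A p.1 = p.2].
Definition densely_defined A := dense (dom A).

Section ScalarMinus.
Context (z : C) (A : operator X).

Fact scalar_minus_linear a x y : dom A x -> dom A y ->
  z *: (a *: x + y) - A (a *: x + y) = a *: (z *: x - A x) + (z *: y - A y).
Proof.
move=> Ax Ay; rewrite op_linear// scalerDr scalerBr opprD addrACA.
by rewrite !scalerA mulrC.
Qed.

Definition scalar_minus : operator X :=
  @Operator R X (dom A) (fun x => z *: x - A x)
    (dom0 A) (@dom_linear _ _ A) scalar_minus_linear.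

End ScalarMinus.

Definition id_op : operator X :=
  @Operator R X setT id I (fun _ _ _ _ _ => I) (fun _ _ _ _ _ => erefl).

Section Composition.
Context (A B : operator X).

Definition comp_dom : set X := [set x | dom B x /\ dom A (B x)].

Fact comp_dom0 : comp_dom 0.
Proof. by split; rewrite ?op0; exact: dom0. Qed.
Fact comp_dom_linear a x y :
  comp_dom x -> comp_dom y -> comp_dom (a *: x + y).
Proof.
move=> [Bx ABx] [By ABy]; split; first exact: dom_linear.
by rewrite op_linear//; exact: dom_linear.
Qed.
Fact comp_linear a x y : comp_dom x -> comp_dom y ->
  A (B (a *: x + y)) = a *: A (B x) + A (B y).
Proof. by move=> [Bx ABx] [By ABy]; rewrite !op_linear. Qed.

Definition comp_op : operator X :=
  @Operator R X comp_dom (fun x => A (B x))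
    comp_dom0 comp_dom_linear comp_linear.

End Composition.

Definition pow_op A (m : nat) : operator X := iter m (comp_op A) id_op.

Definition eigenvalue_op A (z : C) :=
  exists2 x, ker_op (scalar_minus z A) x & x <> 0.

Definition generalised_eigenspace A (z : C) : set X :=
  \bigcup_m ker_op (pow_op (scalar_minus z A) m).

Definition has_dim (V : set X) (n : nat) := exists b : 'I_n -> X,
  let comb (c : 'rV[C]_n) := \sum_(i < n) c 0 i *: b i in
  injective comb /\ V = range comb.

Definition geometrically_simple A (z : C) :=
  has_dim (ker_op (scalar_minus z A)) 1.
Definition algebraically_simple A (z : C) :=
  has_dim (generalised_eigenspace A z) 1.

Definition is_resolvent A (z : C) (T : {bounded X -> X}) :=
  (forall y, dom A (T y) /\ scalar_minus z A (T y) = y) /\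
  (forall x, dom A x -> T (scalar_minus z A x) = x).

Definition resolvent_set A : set C := [set z | exists T, is_resolvent A z T].
Definition spectrum A : set C := ~` resolvent_set A.

(* Zero, by convention, outside the resolvent set. *)
Definition resolvent A (z : C) : {bounded X -> X} := xget 0 (is_resolvent A z).

Definition isolated_spectral_value A (z0 : C) :=
  spectrum A z0 /\ \forall z \near z0^', resolvent_set A z.

End Operators.

Section Laurent.
Context (R : realType) (V : normedModType (Cplx R)).
Local Notation C := (Cplx R).

(* f z = \sum_(n >= - m) (z - z0)^n *: U n near z0, for z distinct from z0 *)
Definition laurent_expansion (f : C -> V) (z0 : C) (m : nat) (U : int -> V) :=
  (forall n : int, n < - m%:Z -> U n = 0) /\
  \forall z \near z0^',
    series (fun k : nat => (z - z0) ^ (k%:Z - m%:Z) *: U (k%:Z - m%:Z))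
      @ \oo --> f z.

Definition pole_of_order (f : C -> V) (z0 : C) (m : nat) := (0 < m)%N /\
  exists2 U, laurent_expansion f z0 m U & U (- m%:Z) <> 0.

(* The residue at a pole (or at a removable singularity): the expansion has
   finite principal part, and is then unique. *)
Definition residue (f : C -> V) (z0 : C) (a : V) :=
  exists m, exists2 U, laurent_expansion f z0 m U & U (- 1) = a.

End Laurent.

Section SpectralProjection.
Context (R : realType) (X : normedModType (Cplx R)) (A : operator X).

Definition resolvent_pole_of_order (z0 : Cplx R) (m : nat) :=
  isolated_spectral_value A z0 /\ pole_of_order (resolvent A) z0 m.

Definition resolvent_pole (z0 : Cplx R) :=
  exists m, resolvent_pole_of_order z0 m.

Definition spectral_projection (z0 : Cplx R) (P : {bounded X -> X}) :=
  isolated_spectral_value A z0 /\ residue (resolvent A) z0 P.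

End SpectralProjection.

Section DualOperator.
Context (R : realType) (X : normedModType (Cplx R)).
Context (A : operator X) (dA : densely_defined A).

Definition dual_rel (phi psi : dual X) :=
  forall x, dom A x -> phi (A x) = psi x.

Definition dual_dom : set (dual X) := [set phi | exists psi, dual_rel phi psi].

(* Density of dom A makes the value unique, see dual_rel_uniq. *)
Definition dual_fun (phi : dual X) : dual X := xget 0 (dual_rel phi).

Lemma dual_rel_uniq phi psi1 psi2 :
  dual_rel phi psi1 -> dual_rel phi psi2 -> psi1 = psi2.
Proof.
move=> h1 h2; apply: boundedP => x; apply: contrapT => nx.
pose D : dual X := psi1 - psi2.
have oD : open (D @^-1` [set~ 0]).
  apply: open_comp; first by move=> y _; exact: bounded_continuous.
  rewrite openC; apply: accessible_closed_set1.
  exact: hausdorff_accessible (@norm_hausdorff _ _).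
have [|y [Dy Ay]] := dA _ oD.
  by exists x => Dx; apply: nx; apply: subr0_eq.
apply: Dy; suff: psi1 y - psi2 y = 0 by [].
by rewrite -h1// -h2// subrr.
Qed.

Lemma dual_funP phi psi : dual_rel phi psi -> dual_fun phi = psi.
Proof.
move=> h; apply: (@dual_rel_uniq phi) => //.
by rewrite /dual_fun; case: xgetP => [_ -> //|/(_ psi)].
Qed.

Fact dual_rel_linear a phi1 phi2 psi1 psi2 : dual_rel phi1 psi1 ->
  dual_rel phi2 psi2 -> dual_rel (a *: phi1 + phi2) (a *: psi1 + psi2).
Proof.
move=> h1 h2 x Ax.
suff: a *: phi1 (A x) + phi2 (A x) = a *: psi1 x + psi2 x by [].
by rewrite h1 ?h2.
Qed.

Fact dual_dom0 : dual_dom 0.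
Proof. by exists 0. Qed.

Fact dual_dom_linear a phi1 phi2 :
  dual_dom phi1 -> dual_dom phi2 -> dual_dom (a *: phi1 + phi2).
Proof.
move=> [psi1 h1] [psi2 h2]; exists (a *: psi1 + psi2); exact: dual_rel_linear.
Qed.

Fact dual_fun_linear a phi1 phi2 : dual_dom phi1 -> dual_dom phi2 ->
  dual_fun (a *: phi1 + phi2) = a *: dual_fun phi1 + dual_fun phi2.
Proof.
move=> [psi1 h1] [psi2 h2]; rewrite (dual_funP h1) (dual_funP h2).
by apply: dual_funP; exact: dual_rel_linear.
Qed.

Definition dual_operator : operator (dual X) :=
  @Operator R (dual X) dual_dom dual_fun
    dual_dom0 dual_dom_linear dual_fun_linear.

End DualOperator.

Section Positivity.
Context (R : realType) (K : topologicalType) (cK : compact [set: K]).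
Local Notation C := (Cplx R).
Local Notation E := (CK R cK).

(* The order on Cplx R makes 0 <= z mean that z is a nonnegative real. *)
Definition positive_cone : set E := [set f | forall t, 0 <= f t].

Definition positive_nonzero (f : E) := positive_cone f /\ f <> 0.

Definition strongly_positive (f : E) :=
  exists2 beta : R, 0 < beta & forall t, toC beta <= f t.

Definition strongly_positive_op (T : {bounded E -> E}) :=
  forall f, positive_nonzero f -> strongly_positive (T f).

Definition strongly_positive_functional (phi : dual E) :=
  forall f, positive_nonzero f -> 0 < phi f.

Definition real_valued (f : E) := forall t, f t \is Num.real.

Definition real_operator (A : operator E) :=
  (forall f g, real_valued f -> real_valued g -> dom A (f + 'i *: g) ->
    dom A f /\ dom A g) /\
  (forall f, dom A f -> real_valued f -> real_valued (A f)).

End Positivity.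

Arguments positive_cone {R K cK} _.

(* Main.v *)
Require Import Defs.
From mathcomp Require Import all_boot all_order all_algebra.
From mathcomp Require Import all_classical all_reals all_analysis.
From mathcomp.real_closed Require Import complex.
From mathcomp Require Import ring lra zify.

Set Implicit Arguments.
Unset Strict Implicit.
Unset Printing Implicit Defensive.

Import Order.TTheory GRing.Theory Num.Theory.
Import numFieldNormedType.Exports.

Local Open Scope classical_set_scope.
Local Open Scope ring_scope.

(** Expand [R(z, A) = sum_n (z - l0)^n U_n] near [l0], with [P = U_(-1)].
    Comparing coefficients in the resolvent identity with one fixed resolvent
    point gives [(l0 - A) U_n = U_n (l0 - A) = delta_(n0) - U_(n-1)], hence
    [P^2 = P], [1 - P = (l0 - A) U_0], and [im P] lies in the generalised
    eigenspace.  All three assertions amount to [P f = phi(f) u] with [u] a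
    strongly positive eigenvector of [A] and [phi] a strongly positive
    functional.  If [P] is strongly positive, then every real fixed vector [f]
    of [P] is a multiple of [u = P 1]: otherwise [f - inf(f/u) u > 0] is fixed
    by [P], hence strongly positive, contradicting the choice of the infimum.
    Under (iii), [f > 0] cannot satisfy [P f = 0] because
    [ker P] is contained in [im (l0 - A)], nor [phi(f) < 0] because
    [f - phi(f) u] is a positive element of [ker P].  In the rank one case
    [U_(-2) = (A - l0) P = 0], so the pole is simple. *)

(** * Laurent expansions *)

Section LaurentExpansions.
Context (R : realType) (V : normedModType (Cplx R)).
Local Notation C := (Cplx R).

Lemma eq_cvgn (u v : nat -> V) (l : V) :
  u @ \oo --> l -> u =1 v -> v @ \oo --> l.
Proof. by move=> + /funext <-. Qed.

Lemma near_dnbhs_small (z0 e : C) : 0 < e ->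
  \forall z \near z0^', (z != z0) && (`|z - z0| <= e).
Proof.
move=> e0; have := dnbhs_ball z0 e0; apply: filterS => z [].
by rewrite -ball_normE /= distrC => /ltW -> zz0; rewrite andbT; exact/eqP.
Qed.

Lemma dnbhs_ex (z0 : C) (Q : set C) :
  (\forall z \near z0^', Q z) -> exists z, Q z.
Proof. exact: (@filter_ex _ _ (Proper_dnbhs_numFieldType _)). Qed.

Lemma geometric_sum_le2 (q : C) N : 0 <= q -> q <= 2^-1 ->
  \sum_(k < N) q ^+ k <= 2.
Proof.
move=> q0 q1; elim: N => [|N IH]; first by rewrite big_ord0.
rewrite big_ord_recl expr0.
under eq_bigr do rewrite lift0 exprS.
rewrite -mulr_sumr [leRHS](_ : _ = 1 + 2^-1 * 2); last first.
  by rewrite mulVf ?pnatr_eq0.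
by rewrite lerD2l ler_pM// sumr_ge0// => i _; rewrite exprn_ge0.
Qed.

(** Convergence at one point z1 bounds all terms there by some M. With r = |z1 - z0|, the terms
    after the first at a nearer z are then dominated by a geometric series with sum at most 2 M |z -
    z0| / r. This cannot cancel a nonzero [a 0] as z tends to z0. *)
Lemma power_series_coef0 (a : nat -> V) (z0 : C) :
  (\forall z \near z0^', series (fun k => (z - z0) ^+ k *: a k) @ \oo --> 0) ->
  a 0%N = 0.
Proof.
move=> a_cvg; apply/eqP/negPn/negP => a0.
have [z1 [/cvgP/cvg_series_cvg_0/cvgP/cvg_seq_bounded z1_bnd z10]] :
    exists z1, series (fun k => (z1 - z0) ^+ k *: a k) @ \oo --> (0 : V) /\
               z1 != z0.
  have [z1 [? ?]] := dnbhs_ex (filterI a_cvg (nbhs_dnbhs_neq z0)).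
  by exists z1.
have /pinfty_ex_gt0 [M M0 aM] := z1_bnd.
set r : C := `|z1 - z0|.
have r0 : 0 < r by rewrite normr_gt0 subr_eq0.
set e : C := `|a 0%N|.
have e0 : 0 < e by rewrite normr_gt0.
have rhalf : 0 < r / 2 by rewrite divr_gt0.
(* At this distance the tail bound 2 M |z - z0| / r is at most e / 2; distance r / 2 keeps the
   geometric ratio below 1/2. *)
have small : 0 < e * r / (4 * M) by rewrite divr_gt0 ?mulr_gt0.
have [z [[z_cvg /andP[z_neq zr]] /andP[_ ze]]] := dnbhs_ex
  (filterI (filterI a_cvg (near_dnbhs_small z0 rhalf))
           (near_dnbhs_small z0 small)).
have /cvgrPdist_lt/(_ (e / 2)) := z_cvg.
rewrite divr_gt0// => /(_ isT) [N _ /(_ N.+1 (leqnSn N))] /=.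
rewrite sub0r normrN /series /= big_mkord big_ord_recl expr0 scale1r.
set S := \sum_(i < N) _.
have SM : `|S| <= e / 2.
  set q : C := `|z - z0| / r.
  have term (i : 'I_N) :
      `|(z - z0) ^+ bump 0 i *: a (bump 0 i)| <= q * M * q ^+ i.
    rewrite /bump leq0n add1n normrZ normrX mulrAC -exprS /q exprMn -mulrA.
    rewrite ler_wpM2l ?exprn_ge0// exprVn mulrC ler_pdivlMr ?exprn_gt0//.
    have := aM i.+1 I; rewrite /= normrZ normrX -/r.
    by rewrite mulrC.
  rewrite (le_trans (ler_norm_sum _ _ _))//.
  rewrite (le_trans (ler_sum _ (fun i _ => term i)))//.
  rewrite -mulr_sumr.
  have q0 : 0 <= q by rewrite divr_ge0 // ltW.
  apply: (@le_trans _ _ (q * M * 2)).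
    apply: ler_wpM2l; first exact: mulr_ge0 q0 (ltW M0).
    apply: geometric_sum_le2 => //.
    by rewrite ler_pdivrMr// mulrC.
  have -> : q * M * 2 = `|z - z0| / r * (2 * M) by rewrite -mulrA (mulrC M).
  have -> : e / 2 = e * r / (4 * M) / r * (2 * M).
    by field; rewrite (gt_eqF M0) (gt_eqF r0).
  rewrite ler_wpM2r ?mulr_ge0 ?(ltW M0)//.
  by rewrite ler_wpM2r ?invr_ge0 ?(ltW r0).
apply/negP; rewrite -real_leNgt ?realE ?(divr_ge0 (ltW e0)) ?normr_ge0//.
rewrite -(lerD2r (e / 2)) -splitr.
rewrite (le_trans _ (lerD (lexx _) SM))//.
rewrite /e -{1}(addrK S (a 0%N)) -(normrN S).
exact: ler_normD.
Qed.

(** Once [a 0] vanishes, division by z - z0 gives the series with shifted coefficients, which again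
    tends to 0 on a punctured neighbourhood. *)
Lemma power_series_eq0 (a : nat -> V) (z0 : C) :
  (\forall z \near z0^', series (fun k => (z - z0) ^+ k *: a k) @ \oo --> 0) ->
  forall n, a n = 0.
Proof.
move=> a_cvg n; elim: n a a_cvg => [|n IH] a a_cvg.
  exact: power_series_coef0 a_cvg.
apply: (IH (fun k => a k.+1)).
have a0 := power_series_coef0 a_cvg.
apply: filterS2 (nbhs_dnbhs_neq z0) a_cvg => z zz0 z_cvg.
have z0n : z - z0 != 0 by rewrite subr_eq0.
rewrite (_ : series _ = (fun N : nat => (z - z0)^-1 *:
    series (fun k => (z - z0) ^+ k *: a k) N.+1)).
  rewrite -(scaler0 _ (z - z0)^-1); apply: cvgZr.
  by rewrite (cvg_shiftS (series (fun k => (z - z0) ^+ k *: a k))).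
apply/funext => N; rewrite /series /= !big_mkord big_ord_recl a0 scaler0 add0r.
rewrite scaler_sumr; apply: eq_bigr => i _.
by rewrite lift0 exprS scalerA mulrA mulVf// mul1r.
Qed.

Implicit Types (f g : C -> V) (U W : int -> V) (m : nat).

Lemma laurent_eq0 f z0 m U : laurent_expansion f z0 m U ->
  (\forall z \near z0^', f z = 0) -> forall n, U n = 0.
Proof.
move=> [U_small U_cvg] f0 n.
have [/U_small//|nm] := ltP n (- m%:Z).
have [k ->] : exists k : nat, n = k%:Z - m%:Z.
  exists (absz (n + m%:Z)); rewrite gez0_abs ?addrK//.
  by rewrite -lerBlDr sub0r.
apply: (@power_series_eq0 (fun k => U (k%:Z - m%:Z)) z0).
apply: filterS3 (nbhs_dnbhs_neq z0) U_cvg f0 => z zz0 z_cvg fz.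
have z0n : z - z0 != 0 by rewrite subr_eq0.
rewrite fz in z_cvg.
rewrite (_ : series _ = (fun N : nat => (z - z0) ^+ m *:
    series (fun k : nat => (z - z0) ^ (k%:Z - m%:Z) *: U (k%:Z - m%:Z)) N)).
  by rewrite -(scaler0 _ ((z - z0) ^+ m)); exact: cvgZr.
apply/funext => N; rewrite /series /= scaler_sumr; apply: eq_bigr => i _.
rewrite scalerA; congr (_ *: _).
by rewrite !exprnP -expfzDr// subrKC.
Qed.

Lemma eq_laurent f g z0 m U : laurent_expansion f z0 m U ->
  (\forall z \near z0^', f z = g z) -> laurent_expansion g z0 m U.
Proof.
move=> [U_small U_cvg] fg; split => //.
by apply: filterS2 U_cvg fg => z z_cvg <-.
Qed.

Lemma laurentD f g z0 m U W :
  laurent_expansion f z0 m U -> laurent_expansion g z0 m W ->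
  laurent_expansion (fun z => f z + g z) z0 m (fun n => U n + W n).
Proof.
move=> [U_small U_cvg] [W_small W_cvg]; split => [n nm|].
  by rewrite U_small// W_small// addr0.
apply: filterS2 U_cvg W_cvg => z Uz Wz.
apply: eq_cvgn (cvgD Uz Wz) _ => N.
rewrite fctE /series /= -big_split/=.
by apply: eq_bigr => i _; rewrite scalerDr.
Qed.

Lemma laurent_cst (v : V) z0 m :
  laurent_expansion (fun=> v) z0 m (fun n => if n == 0 then v else 0).
Proof.
split => [n nm|].
  by rewrite ifN//; apply: contraTneq nm => ->; rewrite -leNgt oppr_le0.
apply: filterS (nbhs_dnbhs_neq z0) => z zz0.
(* After m + 1 terms the exponent 0, at index k = m, has been reached, so the partial sums are
   constant from there on. *)
rewrite -(cvg_shiftn m.+1).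
rewrite (_ : [sequence _]_n = cst v); first exact: cvg_cst.
apply/funext => N; rewrite /series /= big_mkord.
have mN : (m < N + m.+1)%N by rewrite ltn_addl.
rewrite (bigD1 (Ordinal mN))//= subrr eqxx expr0z scale1r.
by rewrite big1 ?addr0// => i im; rewrite subr_eq0 ifN ?scaler0.
Qed.

Lemma laurent_shift f z0 m U : laurent_expansion f z0 m U ->
  laurent_expansion (fun z => (z - z0) *: f z) z0 m (fun n => U (n - 1)).
Proof.
move=> [U_small U_cvg]; split => [n nm|].
  by apply: U_small; rewrite (lt_trans _ nm)// gtrDl.
apply: filterS2 (nbhs_dnbhs_neq z0) U_cvg => z zz0 z_cvg.
have z0n : z - z0 != 0 by rewrite subr_eq0.
rewrite -cvg_shiftS.
apply: eq_cvgn (cvgZr (k := z - z0) z_cvg) _ => N.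
(* The order m is kept, so the first summand carries U (- m - 1) = 0; dropping it aligns the two
   series. *)
rewrite /series /= !big_mkord big_ord_recl U_small ?scaler0 ?add0r; last first.
  by rewrite gtrDl.
rewrite scaler_sumr; apply: eq_bigr => i _.
have -> : (lift ord0 i)%:Z = i%:Z + 1 by rewrite lift0 -addn1.
rewrite addrAC addrK scalerA; congr (_ *: _).
by rewrite [RHS]expfzDr// expr1z mulrC.
Qed.

Lemma laurent_lower_order f z0 m m' U : laurent_expansion f z0 m U ->
  (m' <= m)%N -> (forall n : int, n < - m'%:Z -> U n = 0) ->
  laurent_expansion f z0 m' U.
Proof.
move=> [_ U_cvg] /subnK mm' U_small; split => //.
apply: filterS U_cvg => z z_cvg.
move: mm' z_cvg; set d := (m - m')%N => <-.
rewrite -[in X in X -> _](cvg_shiftn d) => z_cvg.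
apply: (eq_cvgn z_cvg) => N.
rewrite /series /= !big_mkord addnC big_split_ord /= big1 ?add0r => [|i _].
  by apply: eq_bigr => i _; rewrite !PoszD (addrC d%:Z i) opprD addrA addrK.
by rewrite U_small ?scaler0// PoszD opprD addrA gtrDr subr_lt0 ltz_nat.
Qed.

End LaurentExpansions.

Lemma laurent_map (R : realType) (V W : normedModType (Cplx R))
    (L : {bounded V -> W}) (f : Cplx R -> V) z0 m U :
  laurent_expansion f z0 m U ->
  laurent_expansion (fun z => L (f z)) z0 m (fun n => L (U n)).
Proof.
move=> [U_small U_cvg]; split => [n nm|].
  by rewrite U_small// linear0.
apply: filterS U_cvg => z z_cvg.
apply: eq_cvgn (cvg_comp _ _ z_cvg (@bounded_continuous _ _ _ L _)) _ => N.
rewrite /series /= linear_sum; apply: eq_bigr => i _.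
by rewrite linearZ.
Qed.

Fact scale_linear (R : realType) (V : normedModType (Cplx R)) (a : Cplx R) :
  linear (fun v : V => a *: v).
Proof. by move=> b u v; rewrite scalerDr !scalerA mulrC. Qed.

Definition scale_bounded (R : realType) (V : normedModType (Cplx R))
    (a : Cplx R) : {bounded V -> V} :=
  mkBounded (@scale_linear R V a) (fun x => cvgZr (k := a) cvg_id).

(** Coefficient comparison for identities of resolvent type: with c = mu - z0, the factor c - (z -
    z0) is mu - z. The difference of the two sides has an expansion and vanishes near z0, so
    [laurent_eq0] applies. *)
Lemma laurent_affine_coef (R : realType) (V : normedModType (Cplx R))
    (f h : Cplx R -> V) (v : V) (c z0 : Cplx R) m U W :
  laurent_expansion f z0 m U -> laurent_expansion h z0 m W ->
  (\forall z \near z0^', f z = v + (c - (z - z0)) *: h z) ->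
  forall n, U n = (if n == 0 then v else 0) + c *: W n - W (n - 1).
Proof.
move=> fU hW fh n; apply/eqP; rewrite -subr_eq0; apply/eqP.
have E := laurentD fU (laurentD (laurent_cst (- v) z0 m)
  (laurentD (laurent_map (scale_bounded V (- c)) hW) (laurent_shift hW))).
have /(laurent_eq0 E)/(_ n) : \forall z \near z0^',
    f z + (- v + (scale_bounded V (- c) (h z) + (z - z0) *: h z)) = 0.
  apply: filterS fh => z ->; rewrite /scale_bounded /= scalerBl scaleNr.
  by rewrite addrACA subrr add0r addrACA subrr addNr addr0.
rewrite /scale_bounded /= scaleNr => E0; rewrite -[RHS]E0.
rewrite !opprD opprK !addrA; congr (_ + _ - _ + _).
by case: ifP => _; rewrite ?oppr0.
Qed.

(** * Laurent coefficients of a resolvent *)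

Section Evaluation.
Context (R : realType) (X Y : normedModType (Cplx R)).

Fact eval_linear (x : X) : linear (fun T : {bounded X -> Y} => T x).
Proof. by []. Qed.

Fact eval_continuous (x : X) : continuous (fun T : {bounded X -> Y} => T x).
Proof.
apply: (@le_continuous _ _ _ _ (eval_linear x) _ (normr_ge0 x)) => T.
by rewrite mulrC; exact: bounded_norm_ub.
Qed.

(** Through [laurent_map], it turns the operator-valued expansion of the resolvent into one of R(z,
    A) x. *)
Definition eval_bounded (x : X) : {bounded {bounded X -> Y} -> Y} :=
  mkBounded (eval_linear x) (@eval_continuous x).

End Evaluation.

Section ResolventExpansion.
Context (R : realType) (X : normedModType (Cplx R)) (A : operator X).
Local Notation C := (Cplx R).

Lemma resolventP (z : C) :
  resolvent_set A z -> is_resolvent A z (resolvent A z).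
Proof. by move=> [T AT]; apply: (xgetPex 0); exists T. Qed.

Lemma op_domZ a x : dom A x -> dom A (a *: x).
Proof.
by move=> Ax; rewrite -[_ *: _]addr0; apply: dom_linear => //; exact: dom0.
Qed.

Lemma op_funZ a x : dom A x -> A (a *: x) = a *: A x.
Proof.
by move=> Ax; rewrite -[_ *: _]addr0 op_linear ?op0 ?addr0//; exact: dom0.
Qed.

Lemma resolvent_identity (z w : C) (S T : {bounded X -> X}) x :
  is_resolvent A z S -> is_resolvent A w T ->
  S x = T x + (w - z) *: T (S x).
Proof.
move=> [/(_ x)[AS Sx] _] [_ /(_ _ AS)] /= TS.
rewrite -linearZ -linearD -{1}TS; congr (T _).
by rewrite /= -[X in _ = X + _]Sx scalerBl [RHS]addrC addrA subrK.
Qed.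

Context (z0 : C) (m : nat) (U : int -> {bounded X -> X}).
Hypothesis UE : laurent_expansion (resolvent A) z0 m U.
Hypothesis near_res : \forall z \near z0^', resolvent_set A z.

(** Coefficients are compared in R(z) x = R(mu) x + (mu - z) R(mu) R(z) x for a fixed mu. This
    exhibits U_n x as a value of R(mu, A), hence as an element of the domain of A. *)
Lemma coef_resolvent (mu : C) (T : {bounded X -> X}) (n : int) x :
  is_resolvent A mu T ->
  U n x = T ((if n == 0 then x else 0) + (mu - z0) *: U n x - U (n - 1) x).
Proof.
move=> AT; have UEx := laurent_map (eval_bounded X x) UE.
have near_id : \forall z \near z0^', eval_bounded X x (resolvent A z) =
    T x + (mu - z0 - (z - z0)) *: T (eval_bounded X x (resolvent A z)).
  apply: filterS near_res => z /resolventP Rz /=.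
  by rewrite opprB addrA subrK; exact: resolvent_identity.
have /= UnE := laurent_affine_coef UEx (laurent_map T UEx) near_id n.
by rewrite linearB linearD linearZ /= [LHS]UnE; case: ifP; rewrite ?linear0.
Qed.

Lemma coef_dom (n : int) x : dom A (U n x).
Proof.
have [mu [T AT]] := dnbhs_ex near_res.
by rewrite (coef_resolvent n x AT); exact: (AT.1 _).1.
Qed.

(** Apply mu - A to the formula of [coef_resolvent] and subtract (mu - z0) U_n x. *)
Lemma coef_right (n : int) x :
  z0 *: U n x - A (U n x) = (if n == 0 then x else 0) - U (n - 1) x.
Proof.
have [mu [T AT]] := dnbhs_ex near_res.
have UnE := coef_resolvent n x AT.
have [_ /=] := AT.1 ((if n == 0 then x else 0) + (mu - z0) *: U n x - U (n - 1) x).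
rewrite -UnE => UnA.
apply: (@addrI _ ((mu - z0) *: U n x)).
by rewrite addrA -scalerDl subrK UnA addrA (addrC _ (_ *: _)).
Qed.

Lemma coef_left (n : int) x : dom A x ->
  U n (z0 *: x - A x) = (if n == 0 then x else 0) - U (n - 1) x.
Proof.
move=> Ax; have [mu [T AT]] := dnbhs_ex near_res.
(* For this y, R(z) y = x + (mu - z) R(z) x, which has the shape required by
   [laurent_affine_coef]. *)
pose y := mu *: x - A x.
have Ty : T y = x by have [_ /(_ x Ax)] := AT.
have UEy := laurent_map (eval_bounded X y) UE.
have UEx := laurent_map (eval_bounded X x) UE.
have near_id : \forall z \near z0^', eval_bounded X y (resolvent A z) =
    x + (mu - z0 - (z - z0)) *: eval_bounded X x (resolvent A z).
  apply: filterS near_res => z /resolventP Rz /=.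
  have := resolvent_identity y AT Rz; rewrite Ty => xE.
  rewrite [X in _ = X + _]xE.
  by rewrite opprB addrA subrK -addrA -scalerDl addrA subrK subrr scale0r addr0.
have /= UnE := laurent_affine_coef UEy UEx near_id n.
have -> : z0 *: x - A x = y - (mu - z0) *: x.
  by rewrite /y scalerBl opprB [RHS]addrC addrA subrK.
by rewrite linearB linearZ /= UnE addrAC addrK.
Qed.

(** Evaluate U_n (z0 - A) U_k x in two ways, by [coef_left] and by [coef_right]. *)
Lemma coef_shift (n k : int) x : U (n - 1) (U k x) =
  U n (U (k - 1) x) + (if n == 0 then U k x else 0)
  - (if k == 0 then U n x else 0).
Proof.
have := coef_left n (coef_dom k x); rewrite coef_right linearB.
set a := U n (U (k - 1) x); set d := if n == 0 then _ else _.
set b := U (n - 1) _ => E.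
have -> : (if k == 0 then U n x else 0) = U n (if k == 0 then x else 0).
  by case: ifP => _; rewrite ?linear0.
by rewrite -[LHS](subKr d) -E opprB addrA [d + a]addrC.
Qed.

(* By coef_shift, U_n U_k = U_(n+1) U_(k-1), which lowers k until U_k = 0. *)
Lemma coef_mul_principal (j : nat) (n k : int) x :
  0 <= n -> k = j%:Z - m%:Z - 1 -> k < 0 -> U n (U k x) = 0.
Proof.
have [U_small _] := UE.
elim: j n k => [|j IH] n k n0 kE k0.
  by rewrite (U_small k) ?linear0// kE sub0r gtrDl.
have := coef_shift (n + 1) k x; rewrite addrK => ->.
rewrite IH ?addr_ge0//; last 2 first.
- by rewrite kE -addn1 PoszD; ring.
- by rewrite (lt_trans _ k0)// gtrDl.
by rewrite (gt_eqF (ltr_wpDl n0 ltr01)) (lt_eqF k0) addr0 subr0.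
Qed.

Lemma coef_nonneg_neg (n k : int) x : 0 <= n -> k < 0 -> U n (U k x) = 0.
Proof.
move=> n0 k0; have [km|mk] := ltP k (- m%:Z).
  by have [U_small _] := UE; rewrite (U_small k)// linear0.
apply: (@coef_mul_principal (absz (k + m%:Z + 1))) => //.
rewrite gez0_abs; first by ring.
by rewrite addr_ge0// -lerBlDr sub0r.
Qed.

(** By [coef_shift] the left side is U_0 U_(-2) x + U_(-1) x, and the first term vanishes by
    [coef_nonneg_neg]. *)
Lemma residue_idempotent x : U (- 1) (U (- 1) x) = U (- 1) x.
Proof.
have := coef_shift 0 (- 1) x; rewrite sub0r eqxx /= => ->.
by rewrite coef_nonneg_neg// add0r subr0.
Qed.

Lemma residue_eigen x : dom A x -> A x = z0 *: x -> U (- 1) x = x.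
Proof.
move=> Ax Axz; have := coef_left 0 Ax; rewrite Axz subrr linear0 sub0r eqxx.
by move=> /esym/eqP; rewrite subr_eq0 => /eqP.
Qed.

(** By [coef_right], each coefficient below U_(-2) is the image under A - z0 of the one above it, so
    vanishing propagates downwards. *)
Lemma principal_part_simple : (0 < m)%N -> (forall x, U (- 2) x = 0) ->
  laurent_expansion (resolvent A) z0 1 U.
Proof.
move=> m_gt0 U2; have U_small (j : nat) : U (- (j%:Z + 2)) = 0.
  elim: j => [|j IH]; apply: boundedP => x; first exact: U2.
  have := coef_right (- (j%:Z + 2)) x.
  rewrite IH /= op0 scaler0 subr0 ifN ?oppr_eq0 ?gt_eqF ?ltr_wpDl//.
  move=> /esym/eqP; rewrite sub0r oppr_eq0 => /eqP <-.
  by congr (U _ x); rewrite -addn1 PoszD; ring.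
have U_lt1 (n : int) : n < - 1%:Z -> U n = 0.
  move=> n1; rewrite (_ : n = - ((absz (- n - 2))%:Z + 2)) ?U_small//.
  rewrite gez0_abs; first by ring.
  lia.
exact: laurent_lower_order UE m_gt0 U_lt1.
Qed.

End ResolventExpansion.

(** Iterating [coef_right] gives (z0 - A)^k U_(-1) = (-1)^k U_(-1-k), which is 0 at k = m because -1
    - m < -m. *)
Lemma residue_generalised (R : realType) (X : normedModType (Cplx R))
    (A : operator X) (z0 : Cplx R) (m : nat) (U : int -> {bounded X -> X}) x :
  laurent_expansion (resolvent A) z0 m U ->
  (\forall z \near z0^', resolvent_set A z) ->
  generalised_eigenspace A z0 (U (- 1) x).
Proof.
move=> UE near_res.
have powE (k : nat) : dom (pow_op (scalar_minus z0 A) k) (U (- 1) x) /\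
    pow_op (scalar_minus z0 A) k (U (- 1) x) = (-1) ^+ k *: U (- 1 - k%:Z) x.
  elim: k => [|k [domk kE]]; first by rewrite subr0 expr0 scale1r.
  rewrite /pow_op iterS -/(pow_op _ k) /= /comp_dom /= kE.
  have dk := coef_dom UE near_res (- 1 - k%:Z) x.
  split; first by split; [exact: domk|exact: op_domZ].
  rewrite op_funZ// scalerA mulrC -scalerA -scalerBr.
  rewrite (coef_right UE near_res) ifN; last by rewrite lt_eqF//; lia.
  rewrite sub0r scalerN -scaleNr exprS mulN1r; congr (_ *: U _ x).
  by lia.
exists m => //; have [domm mE] := powE m; split => //; rewrite mE.
have [U_small _] := UE.
by rewrite U_small ?scaler0// gtrDr.
Qed.

Lemma has_dim1P (R : realType) (X : normedModType (Cplx R)) (V : set X) :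
  has_dim V 1 <-> exists2 u, u <> 0 & forall x, V x <-> exists c, x = c *: u.
Proof.
split=> [[b [comb_inj VE]]|[u u0 VE]].
  exists (b ord0) => [b0|x].
    have /(_ (const_mx 1) 0) := comb_inj.
    rewrite !big_ord1 b0 !scaler0 => /(_ erefl)/matrixP/(_ ord0 ord0)/eqP.
    by rewrite !mxE oner_eq0.
  rewrite VE; split => [[c _ <-]|[c ->]].
    by exists (c 0 0); rewrite big_ord1.
  by exists (const_mx c) => //; rewrite big_ord1 mxE.
exists (fun=> u); split=> [c d|].
  rewrite !big_ord1 => /eqP; rewrite -subr_eq0 -scalerBl scaler_eq0 subr_eq0.
  move=> /orP[/eqP cd|/eqP//]; apply/matrixP => i j.
  by rewrite !ord1.
apply/seteqP; split => [x /VE[c ->]|x [c _ <-]].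
  by exists (const_mx c) => //; rewrite big_ord1 mxE.
by apply/VE; exists (c 0 0); rewrite big_ord1.
Qed.

(** * Resolvents of the dual operator *)

Section DualResolvent.
Context (R : realType) (X : normedModType (Cplx R)).
Local Notation C := (Cplx R).

Fact dual_map_linear : linear (@dual_bounded R X X).
Proof.
move=> a S T; apply: boundedP => phi; apply: boundedP => x.
by rewrite [LHS]/= linearP.
Qed.

Fact dual_map_continuous : continuous (@dual_bounded R X X).
Proof.
apply: (@le_continuous _ _ _ _ dual_map_linear 1 ler01) => T.
rewrite mul1r; apply: bounded_norm_le => [|phi]; first exact: sup_norm_ge0.
apply: bounded_norm_le => [|x]; first by rewrite mulr_ge0 ?sup_norm_ge0.
rewrite (le_trans (bounded_norm_ub phi (T x)))// [leRHS]mulrAC mulrC.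
by apply: ler_wpM2r; [exact: sup_norm_ge0|exact: bounded_norm_ub].
Qed.

(** As a bounded map between operator spaces, transposition carries the expansion of R(z, A) to that
    of R(z, A') through [laurent_map]. *)
Definition dual_map :
  {bounded {bounded X -> X} -> {bounded dual X -> dual X}} :=
  mkBounded dual_map_linear dual_map_continuous.

Context (A : operator X) (dA : densely_defined A).

Lemma is_resolvent_unique (z : C) S T :
  is_resolvent A z S -> is_resolvent A z T -> S = T.
Proof.
move=> [zS _] [_ Tz]; apply: boundedP => y.
by have [Sy {2}<-] := zS y; rewrite Tz.
Qed.

Lemma resolventE (z : C) T : is_resolvent A z T -> resolvent A z = T.
Proof.
by move=> AT; apply: is_resolvent_unique (AT); apply: resolventP; exists T.
Qed.

Lemma is_resolvent_dual (z : C) T : is_resolvent A z T ->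
  is_resolvent (dual_operator dA) z (dual_bounded T).
Proof.
move=> [zT Tz].
(* This is psi applied to T (z x - A x) = x. *)
have rel psi : dual_rel A (dual_bounded T psi) (z *: dual_bounded T psi - psi).
  move=> x Ax; have := congr1 psi (Tz x Ax).
  rewrite /= !linearB !linearZ /= => <-.
  by rewrite opprB addrC subrK.
split=> [psi|phi [psi phiA]] /=.
  split; first by exists (z *: dual_bounded T psi - psi); exact: rel.
  by rewrite (dual_funP dA (rel psi)) subKr.
rewrite (dual_funP dA phiA); apply: boundedP => x /=.
have [/phiA Tx] := zT x.
by move=> /(congr1 phi) /=; rewrite linearB linearZ /= Tx => <-.
Qed.

End DualResolvent.

(** * Strongly positive operators on C(K) *)

Section RealValuedFunctions.
Context (R : realType) (K : topologicalType) (cK : compact [set: K]).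
Local Notation C := (Cplx R).
Local Notation E := (CK R cK).
Implicit Types (f g u : E) (x y : R).

Lemma toCD x y : toC (x + y) = toC x + toC y.
Proof. exact: (rmorphD (real_complex R)). Qed.

Lemma toCN x : toC (- x) = - toC x.
Proof. exact: (rmorphN (real_complex R)). Qed.

Lemma toCM x y : toC (x * y) = toC x * toC y.
Proof. exact: (rmorphM (real_complex R)). Qed.

Lemma toC_lt x y : (toC x < toC y) = (x < y).
Proof. exact: ltcR. Qed.

Lemma toC_real x : toC x \is Num.real.
Proof. by rewrite realE -[0]/(toC 0) !toC_le le_total. Qed.

Lemma realP (z : C) : z \is Num.real -> exists x, z = toC x.
Proof.
rewrite realE => /orP[/toC_Re <-|z0]; first by exists (complex.Re z).
exists (- complex.Re (- z)).
by rewrite toCN toC_Re ?oppr_ge0// opprK.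
Qed.

Lemma real_valuedP f :
  real_valued f -> exists r : K -> R, forall t, f t = toC (r t).
Proof.
by move=> rf; have [r fE] := choice (fun t => realP (rf t)); exists r.
Qed.

Lemma CK_le_norm f t : `|f t| <= `|f|.
Proof.
by have [M fM] := CK_bounded f; apply: (@sup_norm_ub R C K setT f M).
Qed.

Lemma CK_real_bounded f (r : K -> R) : (forall t, f t = toC (r t)) ->
  exists2 M : R, 0 < M & forall t, - M <= r t /\ r t <= M.
Proof.
move=> fE; exists (complex.Re (`|f| : C) + 1).
  by rewrite ltr_wpDl// Re_ge0.
move=> t; have := CK_le_norm f t.
rewrite fE real_ler_norml ?toC_real// -(toC_Re (normr_ge0 f)) -toCN !toC_le.
by move=> /andP[? ?]; split; lra.
Qed.

Fact CK_eval_linear t : linear (fun f : E => f t).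
Proof. by []. Qed.

Fact CK_eval_continuous t : continuous (fun f : E => f t).
Proof.
apply: (@le_continuous _ _ _ _ (CK_eval_linear t) 1 ler01) => f.
by rewrite mul1r; exact: CK_le_norm.
Qed.

Definition CK_eval t : dual E :=
  mkBounded (CK_eval_linear t) (@CK_eval_continuous t).

Definition CK_one : E := @mkCK R K cK (cst 1) (fun s => cvg_cst _).

Lemma continuous_Re : continuous (fun z : C => 'Re z).
Proof.
move=> z; apply/(@cvgrPdist_lt _ _ _ (nbhs z) (nbhs_filter z)) => e e0.
have := nbhsx_ballx z e e0; apply: filterS => w.
rewrite -ball_normE /=; apply: le_lt_trans.
by rewrite -raddfB; exact: (leif_normC_Re_Creal _).1.
Qed.

Definition CK_Re f : E := @mkCK R K cK (fun t => 'Re (f t))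
  (fun t => continuous_comp (@CK_continuous _ _ _ f t) (@continuous_Re (f t))).

(** Written as a real part, so that facts about [CK_Re] apply to it directly. *)
Definition CK_Im f : E := CK_Re (- 'i *: f).

Lemma CK_Re_real f : real_valued (CK_Re f).
Proof. by move=> t; exact: Creal_Re. Qed.

Lemma CK_rect f : f = CK_Re f + 'i *: CK_Im f.
Proof.
apply: CKP => t; rewrite [f t]Crect.
suff : 'Im (f t) = 'Re (- 'i * f t) by move=> ->.
by rewrite mulNr raddfN /= ReMil opprK.
Qed.

Lemma CK_rect_inj f g f' g' : real_valued f -> real_valued g ->
  real_valued f' -> real_valued g' -> f + 'i *: g = f' + 'i *: g' -> f = f'.
Proof.
move=> rf rg rf' rg' fg; apply: CKP => t.
have : f t + 'i * g t = f' t + 'i * g' t := congr1 (fun h : E => h t) fg.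
by move=> /(congr1 (fun z : C => 'Re z)); rewrite !Re_rect.
Qed.

Lemma real_valuedB f g : real_valued f -> real_valued g -> real_valued (f - g).
Proof. by move=> rf rg t; exact: rpredB. Qed.

Lemma real_valuedZ (a : C) f :
  a \is Num.real -> real_valued f -> real_valued (a *: f).
Proof. by move=> ra rf t; exact: rpredM. Qed.

Lemma strongly_positive_gt0 f t : strongly_positive f -> 0 < f t.
Proof.
by move=> [b b0 /(_ t)]; apply: lt_le_trans; rewrite -[0]/(toC 0) toC_lt.
Qed.

Lemma strongly_positive_real f : strongly_positive f -> real_valued f.
Proof. by move=> f0 t; rewrite realE ltW ?strongly_positive_gt0. Qed.

Lemma strongly_positiveZ x f : 0 < x -> strongly_positive f ->
  strongly_positive (toC x *: f).
Proof.
move=> x0 [b b0 fb]; exists (x * b) => [|t]; first exact: mulr_gt0.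
have : toC x * toC b <= toC x * f t.
  by apply: ler_wpM2l => //; rewrite -[0]/(toC 0) toC_le ltW.
by rewrite toCM.
Qed.

Lemma strongly_positive_neq0 (t : K) f : strongly_positive f -> f <> 0.
Proof. by move=> /(strongly_positive_gt0 t) + f0; rewrite f0 ltxx. Qed.

Lemma strongly_positive_nonzero (t : K) f :
  strongly_positive f -> positive_nonzero f.
Proof.
move=> f0; split; last exact: (strongly_positive_neq0 t).
by move=> s; rewrite ltW ?strongly_positive_gt0.
Qed.

Lemma CK_one_strongly_positive : strongly_positive CK_one.
Proof. by exists 1 => // t; exact: lexx. Qed.

Section StronglyPositiveOperator.
Context (P : {bounded E -> E}) (P0 : strongly_positive_op P).

(** If M bounds |f|, then f is the difference of the positive functions f + M 1 and M 1. *)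
Lemma strongly_positive_op_real f : real_valued f -> real_valued (P f).
Proof.
have P_cone g : positive_cone g -> real_valued (P g).
  move=> g0; have [->|/eqP gn] := eqVneq g 0.
    by rewrite linear0 => t; exact: real0.
  by apply: strongly_positive_real; exact: P0.
move=> rf; have [r fE] := real_valuedP rf.
have [M M0 rM] := CK_real_bounded fE.
rewrite -(addrK (toC M *: CK_one) f) linearB.
apply: real_valuedB; apply: P_cone => t.
  suff: 0 <= f t + toC M * 1 by [].
  rewrite fE mulr1 -toCD -[0]/(toC 0) toC_le.
  by have [] := rM t; lra.
suff: 0 <= toC M * 1 by [].
by rewrite mulr1 -[0]/(toC 0) toC_le ltW.
Qed.

(* With c the infimum of f / u, the fixed vector f - c u is positive but not
   strongly positive, hence 0. *)
Lemma strongly_positive_op_fix f u (t0 : K) : strongly_positive u ->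
  P u = u -> real_valued f -> P f = f -> exists x, f = toC x *: u.
Proof.
move=> u0 Pu rf Pf; have [r fE] := real_valuedP rf.
have [v uE] := real_valuedP (strongly_positive_real u0).
have [M M0 rM] := CK_real_bounded fE.
have [N N0 vN] := CK_real_bounded uE.
have [b b0 ub] := u0.
have v0 t : 0 < v t by rewrite -toC_lt -uE strongly_positive_gt0.
pose q t := r t / v t.
have q_inf : has_inf (range q).
  split; first by exists (q t0), t0.
  exists (- (M / b)) => _ [t _ <-]; rewrite /q ler_pdivlMr// mulNr.
  have bv : b <= v t by rewrite -toC_le -uE; exact: ub.
  have : M <= M / b * v t.
    by rewrite mulrAC ler_pdivlMr// ler_wpM2l// ltW.
  by have [] := rM t; lra.
exists (inf (range q)); apply/eqP; rewrite -subr_eq0.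
apply/negPn/negP => /eqP gn.
set g := f - _ in gn.
have gE t : g t = toC (r t - inf (range q) * v t).
  by rewrite toCD toCN toCM -fE -uE.
have g_pos : positive_cone g.
  move=> t; suff: 0 <= g t by []; rewrite gE.
  rewrite -[0]/(toC 0) toC_le subr_ge0 -ler_pdivlMr//.
  by apply: ge_inf; [exact: q_inf.2|exists t].
have [d d0] := P0 (conj g_pos gn).
have -> : P g = g by rewrite linearB linearZ /= Pf Pu.
(* From f - c u >= d and u <= N follows f / u >= c + d / N, which contradicts the choice of c. *)
move=> gd; suff : inf (range q) + d / N <= inf (range q).
  by have := divr_gt0 d0 N0; lra.
apply: lb_le_inf; first exact: q_inf.1.
move=> _ [t _ <-]; rewrite /q ler_pdivlMr// mulrDl.
have : d <= r t - inf (range q) * v t by rewrite -toC_le -gE; exact: gd.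
have : d / N * v t <= d.
  by rewrite mulrAC ler_pdivrMr// ler_wpM2l ?(ltW d0)//; have [] := vN t.
lra.
Qed.

End StronglyPositiveOperator.

(** The coefficient is (P f)(t0) / u(t0), which is visibly linear and continuous in f. *)
Lemma rank_one_functional (P : {bounded E -> E}) u (t0 : K) : u t0 != 0 ->
  (forall f, exists c : C, P f = c *: u) ->
  exists phi : dual E, forall f, P f = phi f *: u.
Proof.
move=> ut0 Pu; exists ((u t0)^-1 *: pullback P (CK_eval t0)) => f.
have [c PfE] := Pu f; rewrite PfE; congr (_ *: _).
suff: c = (u t0)^-1 * P f t0 by [].
rewrite PfE; suff: c = (u t0)^-1 * (c * u t0) by [].
by rewrite mulrC mulfK.
Qed.

End RealValuedFunctions.

(** * Eigenvectors and positive projections of rank one *)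

Lemma ker_scalar_minusP (R : realType) (X : normedModType (Cplx R))
    (A : operator X) z x :
  ker_op (scalar_minus z A) x <-> dom A x /\ A x = z *: x.
Proof.
split=> -[Ax]; last by move=> /= AE; split => //=; rewrite AE subrr.
by move=> /= /eqP; rewrite subr_eq0 => /eqP.
Qed.

Lemma ker_dual_operatorP (R : realType) (X : normedModType (Cplx R))
    (A : operator X) (dA : densely_defined A) z phi :
  ker_op (scalar_minus z (dual_operator dA)) phi <->
  forall x, dom A x -> phi (z *: x - A x) = 0.
Proof.
rewrite ker_scalar_minusP; split => [[[psi phiA] /= phiE] x Ax|phi0].
  rewrite linearB linearZ /= phiA//.
  by move: phiE; rewrite (dual_funP dA phiA) => ->; rewrite subrr.
have phiA : dual_rel A phi (z *: phi).
  move=> x /phi0 /eqP; rewrite linearB linearZ subr_eq0 => /eqP <-.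
  by [].
by split; [exists (z *: phi)|exact: dual_funP phiA].
Qed.

Section StronglyPositiveProjection.
Context (R : realType) (K : topologicalType) (cK : compact [set: K]) (t0 : K).
Local Notation C := (Cplx R).
Local Notation E := (CK R cK).
Context (A : operator E) (dA : densely_defined A) (l0 : C).
Context (P : {bounded E -> E}).

(** These five facts are what the Laurent expansion supplies for P = U_(-1); in [P_compl] the
    witness is g = U_0 f. *)
Hypothesis P_idem : forall f, P (P f) = P f.
Hypothesis P_fix : forall f, dom A f -> A f = l0 *: f -> P f = f.
Hypothesis P_comm : forall f, dom A f ->
  P (l0 *: f - A f) = l0 *: P f - A (P f).
Hypothesis P_compl : forall f, exists2 g, dom A g & f - P f = l0 *: g - A g.
Hypothesis P_gen : forall f, generalised_eigenspace A l0 (P f).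

(** Hub of the equivalences: (i) implies it, it implies (i) and (ii), (ii) implies (iii), and (iii)
    implies it. Since P u = u, the normalisation phi(u) = 1 is automatic. *)
Definition positive_rank_one := exists u (phi : dual E),
  [/\ strongly_positive u, dom A u, A u = l0 *: u,
      strongly_positive_functional phi & forall f, P f = phi f *: u].

Lemma strongly_positive_functional_op u (phi : dual E) :
  strongly_positive u -> (forall f, P f = phi f *: u) ->
  strongly_positive_functional phi -> strongly_positive_op P.
Proof.
move=> u0 PE phi0 f /phi0 phif0; rewrite PE.
have [x phifE] : exists x, phi f = toC x by apply: realP; rewrite realE ltW.
by rewrite phifE; apply: strongly_positiveZ; rewrite // -toC_lt -phifE.
Qed.

Lemma strongly_positive_op_rank_one : eigenvalue_op A l0 ->
  strongly_positive_op P -> positive_rank_one.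
Proof.
move=> [v /ker_scalar_minusP[Av AvE] v0] P0.
pose u := P (CK_one R cK).
have u0 : strongly_positive u.
  exact/P0/(strongly_positive_nonzero t0)/CK_one_strongly_positive.
(* The images under P of the real and imaginary parts of f are real and fixed by P, hence real
   multiples of u. *)
have PE f : exists c : C, P f = c *: u.
  have fixE g : exists x, P (CK_Re g) = toC x *: u.
    apply: (strongly_positive_op_fix P0 t0 u0); try exact: P_idem.
    exact (strongly_positive_op_real P0 (CK_Re_real g)).
  have [[x reE] [y imE]] := (fixE f, fixE (- 'i *: f)).
  exists (toC x + 'i * toC y).
  by rewrite [f in LHS]CK_rect linearD linearZ /= reE imE scalerA -scalerDl.
have ut0 : u t0 != 0 by rewrite gt_eqF// strongly_positive_gt0.
have [phi phiE] := rank_one_functional ut0 PE.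
(* A priori u lies only in the generalised eigenspace. Being a multiple of the given eigenvector v,
   it is itself an eigenvector. *)
have vE : v = phi v *: u by rewrite -phiE P_fix.
have phiv0 : phi v != 0.
  by apply/eqP => phiv; apply: v0; rewrite vE phiv scale0r.
have uE : u = (phi v)^-1 *: v by rewrite -[LHS](scalerK phiv0) -vE.
exists u, phi; split => //.
- by rewrite uE; exact: op_domZ.
- by rewrite uE op_funZ// AvE !scalerA mulrC.
move=> f /P0; rewrite phiE => phiu.
have := strongly_positive_gt0 t0 phiu.
suff: (0 < phi f * u t0) -> 0 < phi f by [].
by rewrite pmulr_lgt0// strongly_positive_gt0.
Qed.

Lemma rank_one_kernel u (phi : dual E) f : (forall g, P g = phi g *: u) ->
  dom A f -> A f = l0 *: f -> f = phi f *: u.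
Proof. by move=> PE Af AfE; rewrite -PE P_fix. Qed.

(** Since P commutes with l0 - A, phi((l0 - A) f) u = phi(f) (l0 - A) u = 0. *)
Lemma rank_one_annihilates u (phi : dual E) : u <> 0 -> dom A u ->
  A u = l0 *: u -> (forall g, P g = phi g *: u) ->
  forall f, dom A f -> phi (l0 *: f - A f) = 0.
Proof.
move=> u0 Au AuE PE f Af; have := P_comm Af.
rewrite !PE op_funZ// AuE !scalerA mulrC subrr => /eqP.
by rewrite scaler_eq0 => /orP[/eqP //|/eqP].
Qed.

Lemma rank_one_geometrically_simple : positive_rank_one ->
  geometrically_simple A l0 /\
  (exists2 u, ker_op (scalar_minus l0 A) u & strongly_positive u) /\
  (exists2 phi, ker_op (scalar_minus l0 (dual_operator dA)) phi &
                strongly_positive_functional phi).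
Proof.
move=> [u [phi [u0 Au AuE phi0 PE]]].
have un0 := strongly_positive_neq0 t0 u0.
split; last split.
- apply/has_dim1P; exists u => // f.
  split => [/ker_scalar_minusP[Af AfE]|[c ->]].
    by exists (phi f); exact: rank_one_kernel.
  apply/ker_scalar_minusP; split; first exact: op_domZ.
  by rewrite op_funZ// AuE !scalerA mulrC.
- by exists u => //; exact/ker_scalar_minusP.
- by exists phi => //; apply/ker_dual_operatorP; exact: rank_one_annihilates PE.
Qed.

Lemma geometrically_algebraically_simple : geometrically_simple A l0 /\
  (exists2 u, ker_op (scalar_minus l0 A) u & strongly_positive u) /\
  (exists2 phi, ker_op (scalar_minus l0 (dual_operator dA)) phi &
                strongly_positive_functional phi) ->
  algebraically_simple A l0 /\
  (exists2 u, ker_op (scalar_minus l0 A) u & strongly_positive u) /\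
  im_op (scalar_minus l0 A) `&` positive_cone = [set 0].
Proof.
move=> [/has_dim1P[v v0 kerE] [[u uker u0]]].
move=> [phi /ker_dual_operatorP phiA phi0].
split; last split; last 1 first.
- apply/seteqP; split => [_ [[f Af <-] f0]|_ ->].
    apply: contrapT => fn0; have := phi0 _ (conj f0 fn0).
    by rewrite [scalar_minus l0 A f]/(l0 *: f - A f) phiA// ltxx.
  split=> [|t]; last exact: lexx.
  by exists 0; [exact: dom0|exact: (op0 (scalar_minus l0 A))].
- have [c uE] := (kerE u).1 uker.
  have phi_u : 0 < phi u by exact (phi0 _ (strongly_positive_nonzero t0 u0)).
  have c0 : c != 0.
    by apply: contraTneq phi_u => cz; rewrite uE cz scale0r linear0 ltxx.
  have phiv : phi v != 0.
    apply: contraTneq phi_u => phiv.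
    by rewrite uE linearZ /= phiv scaler0 ltxx.
  (* No Jordan chain of length two: if (l0 - A) f = d v, applying phi gives d phi(v) = 0, so d =
     0. *)
  have ker2 f : dom A f -> ker_op (scalar_minus l0 A) (l0 *: f - A f) ->
      ker_op (scalar_minus l0 A) f.
    move=> Af /kerE[d dE]; split => //=; rewrite dE.
    have := phiA _ Af; rewrite dE linearZ /= => /eqP.
    rewrite -[_ *: _]/(_ * _) mulf_eq0 (negPf phiv) orbF => /eqP ->.
    by rewrite scale0r.
  apply/has_dim1P; exists v => // f; rewrite -kerE; split; last first.
    by move=> [Af fE]; exists 1%N.
  move=> [m _]; elim: m => [|m IH].
    move=> [_ /= ->]; split => //=; first exact: dom0.
    exact: (op0 (scalar_minus l0 A)).
  case: m IH => [_ [[_ Af] fE]|m IH]; first by split.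
  (* Applied to (l0 - A)^m f, [ker2] lowers the exponent from m + 2 to m + 1. *)
  move=> [[domf /= Af] fE]; apply: IH; split => //.
  have [dom1 Apf] := domf.
  exact: (ker2 _ Apf (conj Af fE)).2.
- by exists u.
Qed.

Lemma algebraically_simple_rank_one : real_operator A -> l0 \is Num.real ->
  algebraically_simple A l0 /\
  (exists2 u, ker_op (scalar_minus l0 A) u & strongly_positive u) /\
  im_op (scalar_minus l0 A) `&` positive_cone = [set 0] ->
  positive_rank_one.
Proof.
move=> [A_dom A_real] l0_real [/has_dim1P[v v0 genE] [[u uker u0] im0]].
have un0 := strongly_positive_neq0 t0 u0.
have [Au AuE] := (ker_scalar_minusP _ _ _).1 uker.
have [c uE] : exists c, u = c *: v.
  by apply/genE; exists 1%N => //; case: uker.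
have c0 : c != 0 by apply/eqP => cz; apply: un0; rewrite uE cz scale0r.
have PE f : exists d, P f = d *: u.
  have [d ->] := (genE _).1 (P_gen f).
  by exists (d / c); rewrite uE scalerA mulfVK.
have ut0 : u t0 != 0 by rewrite gt_eqF// strongly_positive_gt0.
have [phi phiE] := rank_one_functional ut0 PE.
have phiA := rank_one_annihilates un0 Au AuE phiE.
have phi_u : phi u = 1.
  have := phiE u; rewrite P_fix// => /eqP; rewrite -subr_eq0 -{1}[u]scale1r.
  by rewrite -scalerBl scaler_eq0 subr_eq0 => /orP[/eqP ->|/eqP].
exists u, phi; split => // f [f0 fn0].
(* If P g = 0, then g = g - P g lies in im(l0 - A), which meets the cone only in 0. *)
have im_ker g : positive_cone g -> phi g = 0 -> g = 0.
  move=> g0 phig; have [h Ah] := P_compl g.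
  rewrite phiE phig scale0r subr0 => gE.
  have : (im_op (scalar_minus l0 A) `&` positive_cone) g.
    by split => //; exists h.
  by rewrite im0.
have f_real : real_valued f by move=> t; rewrite realE f0.
(* Write f - phi(f) u = (l0 - A) g. As A and l0 are real, taking real parts gives f - Re(phi(f)) u =
   (l0 - A) Re g, and applying phi, with phi(u) = 1, yields phi(f) = Re(phi(f)). *)
have phif_real : phi f \is Num.real.
  have [g Ag gE] := P_compl f.
  have [] := A_dom _ _ (CK_Re_real g) (CK_Re_real (- 'i *: g)).
    by rewrite -CK_rect.
  rewrite -/(CK_Im g) => Are Aim.
  have re_real := real_valuedB (real_valuedZ l0_real (CK_Re_real g))
    (A_real _ Are (CK_Re_real g)).
  have im_real := real_valuedB (real_valuedZ l0_real (CK_Re_real (- 'i *: g)))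
    (A_real _ Aim (CK_Re_real (- 'i *: g))).
  have u_real := strongly_positive_real u0.
  have AgE : A g = A (CK_Re g) + 'i *: A (CK_Im g).
    by rewrite {1}[g]CK_rect addrC op_linear// addrC.
  have fE : f - 'Re (phi f) *: u + 'i *: (- ('Im (phi f) *: u)) =
      l0 *: CK_Re g - A (CK_Re g) + 'i *: (l0 *: CK_Im g - A (CK_Im g)).
    rewrite scalerN scalerA -addrA -opprD -scalerDl -Crect -phiE gE.
    rewrite AgE {1}[g]CK_rect scalerBr addrACA -opprD scalerDr.
    by rewrite !scalerA [l0 * _]mulrC.
  have reE : f - 'Re (phi f) *: u = l0 *: CK_Re g - A (CK_Re g).
    apply: CK_rect_inj fE => //.
    + apply: (real_valuedB f_real).
      exact (real_valuedZ (Creal_Re _) u_real).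
    + rewrite -scaleNr; apply: real_valuedZ => //.
      by rewrite rpredN Creal_Im.
  have : phi (f - 'Re (phi f) *: u) = 0 by rewrite reE phiA.
  rewrite linearB linearZ /= phi_u => /eqP; rewrite subr_eq0 => /eqP ->.
  by apply: rpredM; [exact: Creal_Re|exact: real1].
rewrite lt_def; apply/andP; split.
  by apply/eqP => phif; apply: fn0; exact: im_ker.
have [x phifE] := realP phif_real; rewrite phifE -[0]/(toC 0) toC_le.
rewrite leNgt; apply/negP => x0.
have gE : f - phi f *: u = 0.
  apply: im_ker => [t|]; last first.
    rewrite linearB linearZ /= phi_u; apply/eqP.
    by rewrite subr_eq0 eq_sym; apply/eqP; exact: mulr1.
  suff: 0 <= f t + toC (- x) * u t.
    by rewrite toCN mulNr phifE.
  apply: addr_ge0 => //; apply: mulr_ge0.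
    by rewrite -[0]/(toC 0) toC_le oppr_ge0 ltW.
  by rewrite ltW// strongly_positive_gt0.
(* Now f = phi(f) u with phi(f) < 0 is nonpositive as well as positive, hence 0. *)
apply: fn0; apply: CKP => t; apply/eqP; rewrite eq_le; apply/andP; split=> //.
have -> : f = phi f *: u by apply/eqP; rewrite -subr_eq0 gE.
suff: toC x * u t <= 0 by rewrite phifE.
apply: mulr_le0_ge0; first by rewrite -[0]/(toC 0) toC_le ltW.
by rewrite ltW// strongly_positive_gt0.
Qed.

(** If A f = mu f, then phi annihilates (l0 - A) f = (l0 - mu) f, while phi(f) > 0 for f > 0. *)
Lemma rank_one_positive_eigenvalue : positive_rank_one -> forall mu : C,
  (exists2 f, ker_op (scalar_minus mu A) f & positive_nonzero f) <-> mu = l0.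
Proof.
move=> [u [phi [u0 Au AuE phi0 PE]]] mu.
have un0 := strongly_positive_neq0 t0 u0.
split=> [[f /ker_scalar_minusP[Af AfE] fpos]|->]; last first.
  exists u; first exact/ker_scalar_minusP.
  exact (strongly_positive_nonzero t0 u0).
have := rank_one_annihilates un0 Au AuE PE Af; rewrite AfE -scalerBl linearZ.
move=> /eqP; rewrite /= -[_ *: _]/(_ * _) mulf_eq0 (gt_eqF (phi0 _ fpos)) orbF.
by rewrite subr_eq0 => /eqP.
Qed.

Lemma rank_one_range : positive_rank_one -> has_dim (range P) 1.
Proof.
move=> [u [phi [u0 Au AuE phi0 PE]]].
apply/has_dim1P; exists u; first exact (strongly_positive_neq0 t0 u0).
move=> f; split=> [[g _ <-]|[c ->]]; first by exists (phi g).
by exists (c *: u) => //; rewrite linearZ /= P_fix.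
Qed.

Lemma rank_one_range_dual :
  positive_rank_one -> has_dim (range (dual_bounded P)) 1.
Proof.
move=> [u [phi [u0 Au AuE phi0 PE]]].
have phi_u : 0 < phi u by exact (phi0 _ (strongly_positive_nonzero t0 u0)).
apply/has_dim1P; exists phi => [phi_eq0|psi].
  by move: phi_u; rewrite phi_eq0 ltxx.
(* The dual projection has rank one with the roles of u and phi exchanged. *)
have dualE chi : dual_bounded P chi = chi u *: phi.
  apply: boundedP => f /=; rewrite PE linearZ /=.
  suff: phi f * chi u = chi u * phi f by [].
  exact: mulrC.
split=> [[chi _ <-]|[c ->]]; first by exists (chi u).
exists ((c / phi u) *: phi) => //; rewrite dualE.
suff: (c / phi u * phi u) *: phi = c *: phi by [].
by rewrite divfK// gt_eqF.
Qed.

End StronglyPositiveProjection.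

(** * The equivalence and its consequences *)

Theorem proposition3p1 (R : realType) (K : topologicalType)
    (K0 : [set: K] !=set0) (cK : compact [set: K]) (hK : hausdorff_space K)
    (A : operator (CK R cK)) (clA : closed_operator A)
    (dA : densely_defined A) (rA : real_operator A)
    (lambda0 : R) (ev : eigenvalue_op A (toC lambda0))
    (pl : resolvent_pole A (toC lambda0))
    (P : {bounded CK R cK -> CK R cK})
    (hP : spectral_projection A (toC lambda0) P) :
  let l0 := toC lambda0 in
  let A' := dual_operator dA in
  let P' := dual_bounded P in
  let cond_i := strongly_positive_op P in
  let cond_ii := geometrically_simple A l0 /\
    (exists2 u, ker_op (scalar_minus l0 A) u & strongly_positive u) /\
    (exists2 phi, ker_op (scalar_minus l0 A') phi &
                  strongly_positive_functional phi) in
  let cond_iii := algebraically_simple A l0 /\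
    (exists2 u, ker_op (scalar_minus l0 A) u & strongly_positive u) /\
    im_op (scalar_minus l0 A) `&` positive_cone = [set 0] in
  (cond_i <-> cond_ii) /\ (cond_ii <-> cond_iii) /\
  (cond_i ->
    resolvent_pole_of_order A l0 1 /\
    resolvent_pole_of_order A' l0 1 /\
    has_dim (range P) 1 /\
    has_dim (range P') 1 /\
    forall mu : Cplx R,
      (exists2 f, ker_op (scalar_minus mu A) f & positive_nonzero f) <->
      mu = l0).
Proof.
move=> l0 A' P' cond_i cond_ii cond_iii.
have [t0 _] := K0.
have [[l0_spec near_res] [m [U UE UP]]] := hP.
have P_idem f : P (P f) = P f.
  by rewrite -UP; exact: residue_idempotent UE near_res f.
have P_fix f : dom A f -> A f = l0 *: f -> P f = f.
  by rewrite -UP; exact: residue_eigen UE near_res f.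
have P_comm f : dom A f -> P (l0 *: f - A f) = l0 *: P f - A (P f).
  move=> Af; rewrite -UP (coef_left UE near_res)//.
  by rewrite (coef_right UE near_res).
have P_compl f : exists2 g, dom A g & f - P f = l0 *: g - A g.
  exists (U 0 f); first exact: coef_dom UE near_res 0 f.
  by rewrite (coef_right UE near_res) -UP.
have P_gen f : generalised_eigenspace A l0 (P f).
  by rewrite -UP; exact: residue_generalised UE near_res.
have i_core := strongly_positive_op_rank_one t0 P_idem P_fix ev.
have core_i : positive_rank_one A l0 P -> cond_i.
  move=> [u [phi [u0 _ _ phi0 PE]]].
  exact: strongly_positive_functional_op PE phi0.
have core_ii := rank_one_geometrically_simple t0 dA P_fix P_comm.
have ii_iii := @geometrically_algebraically_simple R K cK t0 A dA l0.
have iii_core := algebraically_simple_rank_one t0 P_fix P_comm P_compl P_gen rA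
  (toC_real lambda0).
split; first by split=> [/i_core/core_ii|/ii_iii/iii_core/core_i].
split; first by split=> [/ii_iii|/iii_core/core_ii].
move=> /i_core core; have [u [phi [u0 Au AuE phi0 PE]]] := core.
have un0 := strongly_positive_neq0 t0 u0.
(* The order m supplied by the residue is arbitrary; m = 0 would force P = U_(-1) = 0, against P u =
   u. *)
have m_gt0 : (0 < m)%N.
  rewrite lt0n; apply/eqP => m0; apply: un0; rewrite -(P_fix u)// -UP.
  by have [U_small _] := UE; rewrite U_small// m0.
have U2 f : U (- 2) f = 0.
  have := coef_right UE near_res (- 1) f; rewrite UP PE op_funZ// AuE.
  rewrite /l0 !scalerA mulrC subrr sub0r => /esym/eqP.
  by rewrite oppr_eq0 => /eqP.
have UE1 := principal_part_simple UE near_res m_gt0 U2.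
have near_dual : \forall z \near l0^', resolvent_set A' z.
  apply: filterS near_res => z [T AT].
  by exists (dual_bounded T); exact: is_resolvent_dual.
have phi_ker : ker_op (scalar_minus l0 A') phi.
  by apply/ker_dual_operatorP; exact: rank_one_annihilates PE.
have phi_u : 0 < phi u := phi0 _ (strongly_positive_nonzero t0 u0).
split; last split; last split; last split.
- split=> //; split=> //; exists U => //; rewrite UP => P0; apply: un0.
  by rewrite -(P_fix u)// P0.
- split.
    (* Here l0 is in the spectrum of A' because phi is an eigenvector. *)
    split=> // -[T [_ AT]]; have [Aphi phiE] := phi_ker.
    by move: phi_u; rewrite -(AT phi Aphi) phiE linear0 ltxx.
  split=> //; exists (fun n => dual_map _ (U n)).
    apply: eq_laurent (laurent_map (dual_map _) UE1) _.
    apply: filterS near_res => z /resolventP AT.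
    by apply/esym/resolventE; exact: is_resolvent_dual.
  rewrite UP => P0; move: phi_u.
  (* The residue P' is nonzero, since (P' phi)(u) = phi(P u) = phi(u) > 0. *)
  have := congr1 (fun T : {bounded dual _ -> dual _} => T phi u) P0.
  by rewrite /= P_fix// => ->; rewrite ltxx.
- exact: rank_one_range core.
- exact: rank_one_range_dual core.
- exact: rank_one_positive_eigenvalue core.
Qed.
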